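(* Let $\Omega\subset\mathbb R^2$ be a bounded open convex domain and let $P\subset\Omega$ be finite. For every $T(x)=Ax+b$ with $A\in\mathrm{GL}(2,\mathbb Z)$ (so $|\det A|=1$) and $b\in\mathbb R^2$, $$G_{T(P)}0_{T\Omega}=(G_P0_\Omega)\circ T^{-1}.$$
   Context: A tropical series on a bounded open convex domain $\Omega\subset\mathbb R^2$ is a continuous function $F:\overline\Omega\to\mathbb R_{\ge0}$ with $F=0$ on $\partial\Omega$ which near every point of $\Omega$ has the form $F(x)=\min_{m\in S}(c_m+\langle m,x\rangle)$ with $S\subset\mathbb Z^2$ finite and $c_m\in\mathbb R$. Its corner locus $V(F)\subset\Omega$ is the set of points where the minimum is attained by at least two distinct affine functions. For finite $P\subset\Omega$, the tropical relaxation $G_P0_\Omega$ is the pointwise infimum of all tropical series $G$ on $\Omega$ with $P\subset V(G)$. *)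

(* Defs.v *)
From mathcomp Require Import all_boot all_order all_algebra.
From mathcomp Require Import all_classical all_reals all_analysis.
Set Implicit Arguments.
Unset Strict Implicit.
Unset Printing Implicit Defensive.
Import Order.TTheory GRing.Theory Num.Theory.
Import numFieldNormedType.Exports.
Local Open Scope classical_set_scope.
Local Open Scope ring_scope.

Definition int_pairing (R : realType) (m : 'cV[int]_2) (x : 'cV[R]_2) : R :=
  \sum_(i < 2) (m i 0)%:~R * x i 0.

(* [c] is total; only its values on the finite set of slopes matter. *)
Definition int_affine (R : realType) (c : 'cV[int]_2 -> R) (m : 'cV[int]_2)
    (x : 'cV[R]_2) : R :=
  c m + int_pairing m x.

Definition is_min (R : realType) (A : set R) (v : R) : Prop :=
  A v /\ lbound A v.

(* [S] is automatically nonempty, since the minimum is required to be attained. *)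
Definition is_local_min_form (R : realType) (F : 'cV[R]_2 -> R) (x : 'cV[R]_2)
    (S : set 'cV[int]_2) (c : 'cV[int]_2 -> R) : Prop :=
  finite_set S /\
  \forall y \near x, is_min [set int_affine c m y | m in S] (F y).

(* A function on the closure of [Omega] is encoded as a total function whose
   values outside the closure are never constrained nor used. For [Omega] open,
   [closure Omega `\` Omega] is its topological boundary. *)
Record tropical_series (R : realType) (Omega : set 'cV[R]_2)
    (F : 'cV[R]_2 -> R) : Prop := TropicalSeries {
  tropical_continuous : {within closure Omega, continuous F} ;
  tropical_ge0 : forall x, closure Omega x -> 0 <= F x ;
  tropical_boundary : forall x, (closure Omega `\` Omega) x -> F x = 0 ;
  tropical_local_min : forall x, Omega x ->
    exists (S : set 'cV[int]_2) (c : 'cV[int]_2 -> R),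
      is_local_min_form F x S c }.

(* Slopes are pairwise distinct in [S], so distinct affine functions are those
   of distinct slopes. Whether two of them attain the minimum at [x] does not
   depend on the chosen local form: it means that [F] is not affine near [x]. *)
Definition corner_locus (R : realType) (Omega : set 'cV[R]_2)
    (F : 'cV[R]_2 -> R) : set 'cV[R]_2 :=
  [set x | Omega x /\
    exists (S : set 'cV[int]_2) (c : 'cV[int]_2 -> R),
      is_local_min_form F x S c /\
      exists m m' : 'cV[int]_2,
        [/\ S m, S m', m <> m', int_affine c m x = F x
          & int_affine c m' x = F x]].

(* Meaningful for [x] in the closure of [Omega], where the set of values is
   bounded below by 0. *)
Definition tropical_relaxation (R : realType) (Omega P : set 'cV[R]_2)
    (x : 'cV[R]_2) : R :=
  inf [set G x | G in
        [set G | tropical_series Omega G /\ P `<=` corner_locus Omega G]].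

Definition int_mx (R : realType) (A : 'M[int]_2) : 'M[R]_2 :=
  map_mx (fun z : int => z%:~R) A.

Definition affine_map (R : realType) (A : 'M[int]_2) (b x : 'cV[R]_2)
    : 'cV[R]_2 :=
  int_mx R A *m x + b.

Definition affine_map_inv (R : realType) (A : 'M[int]_2) (b y : 'cV[R]_2)
    : 'cV[R]_2 :=
  invmx (int_mx R A) *m (y - b).

Lemma affine_mapK (R : realType) (A : 'M[int]_2) (b : 'cV[R]_2) :
  A \in unitmx -> cancel (affine_map A b) (affine_map_inv A b).
Proof.
move=> uA x; rewrite /affine_map_inv /affine_map addrK mulKmx //.
by rewrite /int_mx unitmxE det_map_mx rmorph_unit // -unitmxE.
Qed.

Lemma affine_map_invK (R : realType) (A : 'M[int]_2) (b : 'cV[R]_2) :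
  A \in unitmx -> cancel (affine_map_inv A b) (affine_map A b).
Proof.
move=> uA y; rewrite /affine_map_inv /affine_map mulKVmx ?subrK //.
by rewrite /int_mx unitmxE det_map_mx rmorph_unit // -unitmxE.
Qed.

(* Main.v *)
Require Import Defs.
From mathcomp Require Import all_boot all_order all_algebra.
From mathcomp Require Import all_classical all_reals all_analysis.
Import Order.TTheory GRing.Theory Num.Theory.
Import numFieldNormedType.Exports.
Local Open Scope classical_set_scope.
Local Open Scope ring_scope.

(** Precomposition with [T x = A x + b] turns the integral affine function
    [c + <m, x>] into [(c + <m, b>) + <A^T m, x>], which is again integral, and
    [m |-> A^T m] is injective on slopes. Hence precomposition with [T] sends
    tropical series on a domain to tropical series on its preimage and
    corner loci to their preimages. Since [T^-1] has the same form, this is a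
    bijection between the two families whose infima are compared. *)

Lemma affine_map_continuous (R : realType) (A : 'M[int]_2) (b : 'cV[R]_2) :
  continuous (affine_map A b).
Proof.
(* Expanding [A x] along the columns of [A] reduces continuity to that of the two coordinate
   functions. *)
have -> : affine_map A b = fun x : 'cV[R]_2 =>
    x 0 0 *: col 0 (int_mx R A) + x 1 0 *: col 1 (int_mx R A) + b.
  apply/funext => x; congr (_ + _); apply/colP => i.
  rewrite !mxE !big_ord_recl big_ord0 addr0.
  have -> : lift ord0 ord0 = 1 :> 'I_2 by apply/val_inj.
  by rewrite !mxE ![x _ _ * _]mulrC.
have coordZ (i : 'I_2) (v : 'cV[R]_2) :
    continuous (fun x : 'cV[R]_2 => x i 0 *: v).
  by move=> x; apply: (@cvgZr_tmp _ _ _ (nbhs x)); exact: coord_continuous.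
move=> x; apply: (@cvgD _ _ _ (nbhs x)); last exact: cvg_cst.
by apply: (@cvgD _ _ _ (nbhs x)); exact: coordZ.
Qed.

Lemma affine_map_inv_affine (R : realType) (A : 'M[int]_2) (b : 'cV[R]_2) :
  A \in unitmx ->
  affine_map_inv A b = affine_map (invmx A) (- (int_mx R (invmx A) *m b)).
Proof.
move=> uA; apply/funext => y; rewrite /affine_map_inv /affine_map -mulmxBr.
congr (_ *m _).
rewrite -[invmx (int_mx R A)]mul1mx.
have <- : int_mx R (invmx A) *m int_mx R A = 1%:M.
  by rewrite /int_mx -map_mxM mulVmx // map_mx1.
by rewrite mulmxK // /int_mx unitmxE det_map_mx rmorph_unit // -unitmxE.
Qed.

Lemma int_pairing_mulmx (R : realType) (A : 'M[int]_2) (m : 'cV[int]_2)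
    (x : 'cV[R]_2) :
  int_pairing (A^T *m m) x = int_pairing m (int_mx R A *m x).
Proof.
(* As an entry of a matrix product, the pairing inherits the adjunction from the rule for
   transposing a product. *)
have pairE (n : 'cV[int]_2) (z : 'cV[R]_2) :
    int_pairing n z = ((map_mx intr n)^T *m z) 0 0.
  by rewrite mxE; apply: eq_bigr => i _; rewrite !mxE.
by rewrite !pairE map_mxM trmx_mul -map_trmx trmxK mulmxA.
Qed.

Lemma int_pairingD (R : realType) (m : 'cV[int]_2) (x y : 'cV[R]_2) :
  int_pairing m (x + y) = int_pairing m x + int_pairing m y.
Proof.
rewrite /int_pairing -big_split /=; apply: eq_bigr => i _.
by rewrite mxE mulrDr.
Qed.

(** Coefficients are indexed by the new slope [m]; the old slope is recovered as [n = (A^T)^-1 m],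
    and the new constant is [c n + <n, b>]. *)
Definition pullback_coef {R : realType} (A : 'M[int]_2) (b : 'cV[R]_2)
    (c : 'cV[int]_2 -> R) (m : 'cV[int]_2) : R :=
  int_affine c (invmx A^T *m m) b.

Lemma int_affine_pullback (R : realType) (A : 'M[int]_2) (b : 'cV[R]_2)
    (c : 'cV[int]_2 -> R) (m : 'cV[int]_2) (x : 'cV[R]_2) :
  A \in unitmx ->
  int_affine (pullback_coef A b c) (A^T *m m) x
  = int_affine c m (affine_map A b x).
Proof.
move=> uA; rewrite /pullback_coef /int_affine mulKmx ?unitmx_tr //.
by rewrite int_pairing_mulmx int_pairingD -addrA (addrC (int_pairing m b)).
Qed.

Lemma is_local_min_form_pullback (R : realType) (A : 'M[int]_2) (b : 'cV[R]_2)
    (F : 'cV[R]_2 -> R) (x : 'cV[R]_2) (S : set 'cV[int]_2)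
    (c : 'cV[int]_2 -> R) :
  A \in unitmx -> is_local_min_form F (affine_map A b x) S c ->
  is_local_min_form (F \o affine_map A b) x (mulmx A^T @` S)
    (pullback_coef A b c).
Proof.
move=> uA [finS minF]; split; first exact: finite_image.
(* Continuity of [T] pulls the neighbourhood of [T x] carrying the local form back to one of [x];
   there both families of affine functions take the same values. *)
move: (affine_map_continuous _ A b x _ minF).
apply: (@filterS _ (nbhs x)) => y /=.
rewrite image_comp; congr is_min; apply/eq_imagel => m _.
by rewrite /= int_affine_pullback.
Qed.

Lemma continuous_closure_preimage (T U : topologicalType) (f : T -> U)
    (B : set U) :
  continuous f -> closure (f @^-1` B) `<=` f @^-1` closure B.
Proof.
by move=> cf x clx V /cf /clx[y [By Vy]]; exists (f y).
Qed.

Lemma tropical_series_pullback (R : realType) (A : 'M[int]_2) (b : 'cV[R]_2)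
    (Omega : set 'cV[R]_2) (F : 'cV[R]_2 -> R) :
  A \in unitmx -> tropical_series Omega F ->
  tropical_series (affine_map A b @^-1` Omega) (F \o affine_map A b).
Proof.
move=> uA [contF F_ge0 F_bd F_loc].
have cT : continuous (affine_map A b) by exact: affine_map_continuous.
have clT := @continuous_closure_preimage _ _ _ Omega cT.
split.
(* [T] maps the closure of the preimage into the closure of [Omega], so continuity relative to the
   latter can be composed with [T]. *)
- apply/subspace_continuousP => x clx V FV.
  move/subspace_continuousP : contF => /(_ _ (clT _ clx) _ FV) /cT.
  by apply: (@filterS _ (nbhs x)) => y + cly; apply; exact: clT.
- by move=> x /clT /F_ge0.
- by move=> x [/clT clx nx]; exact: F_bd.
- move=> x /F_loc[S [c Sc]].
  by exists (mulmx A^T @` S), (pullback_coef A b c);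
    exact: is_local_min_form_pullback.
Qed.

Lemma corner_locus_pullback (R : realType) (A : 'M[int]_2) (b : 'cV[R]_2)
    (Omega : set 'cV[R]_2) (F : 'cV[R]_2 -> R) :
  A \in unitmx ->
  affine_map A b @^-1` corner_locus Omega F
  `<=` corner_locus (affine_map A b @^-1` Omega) (F \o affine_map A b).
Proof.
move=> uA x [Ox [S [c [Sc [m [m' [Sm Sm' mm' mF m'F]]]]]]]; split=> //.
exists (mulmx A^T @` S), (pullback_coef A b c); split.
  exact: is_local_min_form_pullback.
exists (A^T *m m), (A^T *m m'); split; [by exists m|by exists m'| | |].
(* Distinct slopes stay distinct because [A^T] is invertible. *)
- by move/(can_inj (mulKmx _)) => /(_ _)/mm'; apply; rewrite unitmx_tr.
- by rewrite int_affine_pullback.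
- by rewrite int_affine_pullback.
Qed.

Lemma relaxation_family_pullback (R : realType) (A : 'M[int]_2) (b : 'cV[R]_2)
    (Omega P : set 'cV[R]_2) (G : 'cV[R]_2 -> R) :
  A \in unitmx -> tropical_series Omega G -> P `<=` corner_locus Omega G ->
  tropical_series (affine_map A b @^-1` Omega) (G \o affine_map A b) /\
  affine_map A b @^-1` P
  `<=` corner_locus (affine_map A b @^-1` Omega) (G \o affine_map A b).
Proof.
move=> uA tG PG; split; first exact: tropical_series_pullback.
by move=> x /PG; exact: corner_locus_pullback.
Qed.

Theorem proposition10p3 (R : realType) (Omega P : set 'cV[R]_2)
    (Omega_bounded : bounded_set Omega) (Omega_open : open Omega)
    (Omega_convex : convex_set Omega)
    (P_finite : finite_set P) (P_sub : P `<=` Omega)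
    (A : 'M[int]_2) (A_GL2Z : A \in unitmx) (b : 'cV[R]_2) :
  forall y : 'cV[R]_2, closure (affine_map A b @` Omega) y ->
    tropical_relaxation (affine_map A b @` Omega) (affine_map A b @` P) y
    = (tropical_relaxation Omega P \o affine_map_inv A b) y.
Proof.
(* The infima agree because the two sets of values are equal. *)
move=> y _ /=; rewrite /tropical_relaxation; congr inf.
have TK := @affine_mapK R A b A_GL2Z; have TVK := @affine_map_invK R A b A_GL2Z.
(* Images under [T] become preimages under its inverse, the form in which the pullback lemmas
   apply. *)
have imT (B : set 'cV[R]_2) : affine_map A b @` B = affine_map_inv A b @^-1` B.
  apply/seteqP; split=> [_ [x Bx <-]|x Bx]; first by rewrite /= TK.
  by exists (affine_map_inv A b x).
have preT (B : set 'cV[R]_2) : affine_map A b @^-1` (affine_map A b @` B) = B.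
  by rewrite imT; apply/seteqP; split=> x /=; rewrite TK.
apply/seteqP; split=> _ [G [tG PG] <-].
  (* A competitor [G] on the image domain pulls back along [T], with value [G y] at [T^-1 y]. *)
  exists (G \o affine_map A b); last by rewrite /= TVK.
  have := @relaxation_family_pullback _ _ b _ _ _ A_GL2Z tG PG.
  by rewrite !preT.
(* Conversely, a competitor on [Omega] is pulled back along the inverse, whose matrix [invmx A] is
   again a unit. *)
exists (G \o affine_map_inv A b) => //.
rewrite !imT affine_map_inv_affine //.
by apply: relaxation_family_pullback; rewrite ?unitmx_inv.
Qed.
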